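(* Let $f_1,\dots,f_m$ be nonnegative real-valued functions on $\mathbb R^d$, let $r_1,\dots,r_m>0$, and let $\theta\in\mathbb R^d$ satisfy $s_i(\theta):=r_i-f_i(\theta)>0$ for all $i$. Suppose $s_j(\theta)\le S_j$ for constants $S_j>0$, $j=1,\dots,m$. Define $$\Phi(\theta)=-\sum_{i=1}^m\log s_i(\theta),\qquad R_{\max}(\mathbf S):=\max_{1\le i\le m}\prod_{j\ne i}S_j,\qquad \psi(\theta):=-\log\min_is_i(\theta).$$ Then $$\min_is_i(\theta)\ge\frac{e^{-\Phi(\theta)}}{R_{\max}(\mathbf S)}\qquad\text{and}\qquad \psi(\theta)-\log R_{\max}(\mathbf S)\le\Phi(\theta)\le m\,\psi(\theta).$$ Moreover, since every objective is nonnegative, $S_j=r_j$ is always a valid choice.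
   Context: An empty product equals $1$. The $f_i$ are task objectives and $r_i$ fixed reference losses. *)

(* Defs.v *)
From HB Require Import structures.
From mathcomp Require Import all_boot all_order all_algebra.
From mathcomp Require Import reals sequences exp.

Set Implicit Arguments.
Unset Strict Implicit.
Unset Printing Implicit Defensive.

Import Order.TTheory GRing.Theory Num.Theory.
Local Open Scope ring_scope.

(* Minimum and maximum of a finite family indexed by a nonempty 'I_m. The
   entry of index 0 serves as the default value of the iterated operation, so
   that no value foreign to the family takes part. *)
Definition fam_min (R : realType) (m : nat) (m_gt0 : (0 < m)%N)
    (a : 'I_m -> R) : R :=
  \big[Num.min/a (Ordinal m_gt0)]_(i < m) a i.

Definition fam_max (R : realType) (m : nat) (m_gt0 : (0 < m)%N)
    (a : 'I_m -> R) : R :=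
  \big[Num.max/a (Ordinal m_gt0)]_(i < m) a i.

Section Barrier.
Variables (R : realType) (d m : nat).
Implicit Types (f : 'I_m -> 'rV[R]_d -> R) (r S : 'I_m -> R).
Implicit Type theta : 'rV[R]_d.

Definition slack f r (i : 'I_m) theta : R := r i - f i theta.

Definition Phi f r theta : R := - \sum_(i < m) ln (slack f r i theta).

Definition min_slack (m_gt0 : (0 < m)%N) f r theta : R :=
  fam_min m_gt0 (fun i => slack f r i theta).

Definition psi (m_gt0 : (0 < m)%N) f r theta : R :=
  - ln (min_slack m_gt0 f r theta).

Definition Rmax (m_gt0 : (0 < m)%N) S : R :=
  fam_max m_gt0 (fun i => \prod_(j < m | j != i) S j).

Definition slack_bounds f r theta S : Prop :=
  forall j : 'I_m, 0 < S j /\ slack f r j theta <= S j.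

End Barrier.

(* Main.v *)
(* If s_k is the least slack, exp(-Phi) is the product of all slacks, that is s_k
   times a product of the others, which is at most R_max; taking logarithms gives
   the lower bound on Phi. The upper bound sums ln s_k <= ln s_i over i. *)
Require Import Defs.
From HB Require Import structures.
From mathcomp Require Import all_boot all_order all_algebra.
From mathcomp Require Import reals sequences exp.

Set Implicit Arguments.
Unset Strict Implicit.
Unset Printing Implicit Defensive.

Import Order.TTheory GRing.Theory Num.Theory.
Local Open Scope ring_scope.

(** The default value is itself an entry of [a], and [Num.min] returns one of its two arguments, so
    every partial minimum stays in the family. *)
Lemma fam_min_eq (R : realType) (m : nat) (m_gt0 : (0 < m)%N)
    (a : 'I_m -> R) : exists k, fam_min m_gt0 a = a k.
Proof.
rewrite /fam_min; elim/big_ind: _ => [|x y [i ->] [j ->]|i _].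
- by exists (Ordinal m_gt0).
- by rewrite minEle; case: ifP => _; [exists i | exists j].
- by exists i.
Qed.

Section Barrier.
Variables (R : realType) (d m : nat) (m_gt0 : (0 < m)%N).
Variables (f : 'I_m -> 'rV[R]_d -> R) (r : 'I_m -> R) (theta : 'rV[R]_d).
Hypothesis slack_gt0 : forall i, 0 < slack f r i theta.

Lemma min_slack_gt0 : 0 < min_slack m_gt0 f r theta.
Proof.
by have [k] := fam_min_eq m_gt0 (slack f r ^~ theta); rewrite /min_slack => ->.
Qed.

Lemma expRN_Phi : expR (- Phi f r theta) = \prod_(i < m) slack f r i theta.
Proof.
by rewrite opprK expR_sum; apply: eq_bigr => i _; rewrite lnK ?posrE.
Qed.

Lemma Rmax_gt0 (S : 'I_m -> R) : slack_bounds f r theta S -> 0 < Rmax m_gt0 S.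
Proof.
(* Any single product would do as a positive lower bound; index 0 exists by [m_gt0]. *)
move=> S_bound; apply: lt_le_trans (le_bigmax _ _ (Ordinal m_gt0)).
by apply: prodr_gt0 => j _; case: (S_bound j).
Qed.

Lemma expRN_Phi_le (S : 'I_m -> R) : slack_bounds f r theta S ->
  expR (- Phi f r theta) <= min_slack m_gt0 f r theta * Rmax m_gt0 S.
Proof.
move=> S_bound; rewrite expRN_Phi.
have [k min_k] := fam_min_eq m_gt0 (slack f r ^~ theta).
rewrite /min_slack min_k (bigD1 k) //= ler_wpM2l ?(ltW (slack_gt0 k)) //.
(* The factors left after removing [k] are compared one by one with the entry of index [k] in the
   maximum. *)
apply: (le_trans _ (le_bigmax _ _ k)); apply: ler_prod => j _.
by rewrite ltW //=; case: (S_bound j).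
Qed.

Lemma Phi_le_psi : Phi f r theta <= m%:R * psi m_gt0 f r theta.
Proof.
(* The multiple by [m] becomes a constant sum over ['I_m], to be compared term by term. *)
rewrite /Phi /psi mulrN lerN2 mulr_natl -[X in _ *+ X]card_ord -sumr_const.
apply: ler_sum => i _; rewrite ler_ln ?posrE ?min_slack_gt0 //.
exact: bigmin_le.
Qed.

End Barrier.

Theorem lemmaA11 (R : realType) (d m : nat) (m_gt0 : (0 < m)%N)
    (f : 'I_m -> 'rV[R]_d -> R) (r : 'I_m -> R) (theta : 'rV[R]_d)
    (f_ge0 : forall (i : 'I_m) (x : 'rV[R]_d), 0 <= f i x)
    (r_gt0 : forall i : 'I_m, 0 < r i)
    (slack_gt0 : forall i : 'I_m, 0 < slack f r i theta) :
  (forall S : 'I_m -> R, slack_bounds f r theta S ->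
     [/\ expR (- Phi f r theta) / Rmax m_gt0 S <= min_slack m_gt0 f r theta,
         psi m_gt0 f r theta - ln (Rmax m_gt0 S) <= Phi f r theta
       & Phi f r theta <= m%:R * psi m_gt0 f r theta])
  /\ slack_bounds f r theta r.
Proof.
split=> [S S_bound|j]; last by split; rewrite // lerBlDr lerDl.
have R_gt0 := Rmax_gt0 m_gt0 S_bound.
have min_gt0 := min_slack_gt0 m_gt0 slack_gt0.
have Phi_min := expRN_Phi_le m_gt0 slack_gt0 S_bound.
split; [by rewrite ler_pdivrMr | | exact: Phi_le_psi].
(* Writing [- Phi] as the logarithm of its exponential turns the goal into [Phi_min] under [ln]. *)
rewrite /psi -opprD lerNl -lnM ?posrE // -[leLHS]expRK.
by rewrite ler_ln ?posrE ?expR_gt0 ?mulr_gt0.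
Qed.
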